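(* Let $(Z_t)$ be a branching process on $[0,\infty]$ and $(v_{s,t})_{(s,t)\in\Delta}$ its Laplace exponents. The following are equivalent: (a) $v_{s,t}\in\mathcal{BF}_\infty$ for all $(s,t)\in\Delta$; (b) for all $0\le s\le t\le u$ and $x>0$, $\mathbb P^{(s,x)}[Z_t\le Z_u]=1$; (c) for all $(s,t)\in\Delta$ and $x>0$, $\mathbb P^{(s,x)}[Z_t\ge x]=1$; (d) for every $(s,t)\in\Delta$ there exists $x>0$ with $\mathbb P^{(s,x)}[Z_t\ge x]=1$.
   Context: $\Delta=\{(s,t):0\le s\le t\}$, $\mathbb H=\{\operatorname{Re}\zeta>0\}$. A branching process on $[0,\infty]$ is a Markov family $(Z_t)$ with probability measures $\mathbb P^{(s,x)}$ ($\mathbb P^{(s,x)}[Z_s=x]=1$ and $\mathbb E^{(s,x)}[f(Z_u)|\mathcal F_{[s,t]}]=\int f(y)k_{t,u}(Z_t,\mathrm dy)$ a.s.) whose transition kernels $(k_{s,t})$ on $[0,\infty]$ satisfy $k_{s,s}(x,\cdot)=\delta_x$, $k_{s,t}\star k_{t,u}=k_{s,u}$ with $(k\star l)(x,B)=\int l(y,B)k(x,\mathrm dy)$, weak continuity of $(s,t,x)\mapsto k_{s,t}(x,\cdot)$ on $\Delta\times[0,\infty)$, $k_{s,t}(x,\cdot)\ast k_{s,t}(y,\cdot)=k_{s,t}(x+y,\cdot)$, $k_{s,t}(0,\cdot)=\delta_0$, $k_{s,t}(\infty,\cdot)=\delta_\infty$. Laplace exponents: Bernstein functions $v_{s,t}$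 with $\int_{[0,\infty)}e^{-\theta y}k_{s,t}(x,\mathrm dy)=e^{-xv_{s,t}(\theta)}$ ($x,\theta>0$), extended holomorphically to $\mathbb H$. $\mathcal{BF}$: Bernstein functions not identically zero (self-maps of $\mathbb H$). Denjoy–Wolff point of $v\in{\sf Hol}(\mathbb H,\mathbb H)$ (not ${\rm id}$, not an elliptic automorphism): unique $\tau\in\overline{\mathbb H}\cup\{\infty\}$ with $v^{\circ n}\to\tau$ locally uniformly. $\mathcal{BF}_\infty$: ${\rm id}_{\mathbb H}$ together with all $v\in\mathcal{BF}\setminus\{{\rm id}\}$ with Denjoy–Wolff point $\infty$. *)

(* Defs.v *)
From HB Require Import structures.
From mathcomp Require Import all_boot all_order all_algebra.
From mathcomp Require Import all_classical all_reals all_analysis.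
From mathcomp Require Import measurable_realfun.
From mathcomp.real_closed Require Import complex.
Import Order.TTheory GRing.Theory Num.Theory.
Import numFieldNormedType.Exports.

Set Implicit Arguments.
Unset Strict Implicit.
Unset Printing Implicit Defensive.

Local Open Scope classical_set_scope.
Local Open Scope ring_scope.
Local Open Scope complex_scope.

Definition Hplane (R : realType) : set (R[i])^o :=
  [set z : (R[i])^o | 0 < complex.Re z].

Definition holomorphic_on (R : realType) (F : (R[i])^o -> (R[i])^o)
    (D : set (R[i])^o) : Prop :=
  forall z, D z -> derivable F z 1.

Definition iter_cvg_infty_locunif (R : realType) (F : (R[i])^o -> (R[i])^o)
    (D : set (R[i])^o) : Prop :=
  forall K : set (R[i])^o, K `<=` D -> compact K ->
  forall M : nat, \forall n \near \oo,
    forall z, K z -> (M%:R : R[i]) < `| iter n F z |.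

(* f : (0,oo) -> [0,oo) is C^oo and (-1)^(n-1) f^(n) >= 0 for n >= 1.
   (Values of f at points <= 0 are irrelevant.) *)
Definition bernstein (R : realType) (f : R -> R) : Prop :=
  [/\ forall x, 0 < x -> 0 <= f x,
      forall (n : nat) x, 0 < x -> derivable (derive1n n f) x 1
    & forall (n : nat) x, 0 < x -> 0 <= (-1) ^+ n * derive1n n.+1 f x].

Definition BF (R : realType) (f : R -> R) : Prop :=
  bernstein f /\ exists x, 0 < x /\ f x != 0.

(* BF_oo : the identity, together with all v in BF \ {id} whose holomorphic
   extension to H (a self-map of H) has Denjoy--Wolff point oo, i.e. whose
   iterates converge to oo locally uniformly on H. *)
Definition BF_infty (R : realType) (f : R -> R) : Prop :=
  (forall x, 0 < x -> f x = x) \/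
  [/\ BF f, exists x, 0 < x /\ f x != x &
      exists F : (R[i])^o -> (R[i])^o,
        [/\ holomorphic_on F (@Hplane R),
            forall x : R, 0 < x -> F x%:C = (f x)%:C,
            forall z, Hplane z -> Hplane (F z)
          & iter_cvg_infty_locunif F (@Hplane R)]].

Definition enonneg (R : realType) : set (\bar R) := [set y : \bar R | (0 <= y)%E].

Definition econv (R : realType) (mu nu : probability (\bar R) R)
    (B : set (\bar R)) : \bar R :=
  (\int[mu]_a \int[nu]_b (\1_B (a + b)%E)%:E)%E.

Definition branching_kernels (R : realType)
    (k : R -> R -> \bar R -> probability (\bar R) R) : Prop :=
  [/\
      forall s t (x : \bar R), 0 <= s <= t -> (0 <= x)%E ->
        k s t x (@enonneg R) = 1%E,
      forall s t (B : set (\bar R)), 0 <= s <= t -> measurable B ->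
        measurable_fun (@enonneg R) (fun x => k s t x B),
      forall s (x : \bar R) (B : set (\bar R)), 0 <= s -> (0 <= x)%E ->
        measurable B -> k s s x B = \d_x B,
      forall s t u (x : \bar R) (B : set (\bar R)), 0 <= s <= t -> t <= u ->
        (0 <= x)%E -> measurable B ->
        k s u x B = (\int[k s t x]_y k t u y B)%E &
      [/\ (* weak continuity of (s,t,x) |-> k_{s,t}(x,.) on Delta x [0,oo) *)
          forall f : \bar R -> R, {within @enonneg R, continuous f} ->
            {within [set p : R * R * R | 0 <= p.1.1 <= p.1.2 /\ 0 <= p.2],
              continuous (fun p : R * R * R =>
                fine (\int[k p.1.1 p.1.2 p.2%:E]_(y in @enonneg R) (f y)%:E)%E)},
          forall s t (x y : \bar R) (B : set (\bar R)), 0 <= s <= t ->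
            (0 <= x)%E -> (0 <= y)%E -> measurable B ->
            econv (k s t x) (k s t y) B = k s t (x + y)%E B,
          forall s t (B : set (\bar R)), 0 <= s <= t -> measurable B ->
            k s t 0%E B = \d_(0%E) B
        & forall s t (B : set (\bar R)), 0 <= s <= t -> measurable B ->
            k s t +oo%E B = \d_(+oo%E) B]].

Definition laplace_exponents (R : realType)
    (k : R -> R -> \bar R -> probability (\bar R) R) (v : R -> R -> R -> R) : Prop :=
  forall s t (x theta : R), 0 <= s <= t -> 0 < x -> 0 < theta ->
    (\int[k s t x%:E]_(y in [set y : \bar R | (0 <= y < +oo)%E])
        (expR (- theta * fine y))%:E)%E
    = (expR (- x * v s t theta))%:E.

Definition past_generators (R : realType) (d : measure_display)
    (Omega : measurableType d) (Z : R -> Omega -> \bar R) (s t : R)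
    : set (set Omega) :=
  [set E | exists (r : R) (B : set (\bar R)),
     [/\ s <= r <= t, measurable B & E = Z r @^-1` B]].

(* Markov family (Z_t, P^{(s,x)}) with transition kernels k:
   P^{(s,x)}[Z_s = x] = 1, and
   E^{(s,x)}[1_B(Z_u) | F_{[s,t]}] = k_{t,u}(Z_t, B) a.s., i.e. for every
   A in F_{[s,t]} : P^{(s,x)}(A /\ Z_u in B) = int_A k_{t,u}(Z_t,B) dP^{(s,x)}. *)
Definition markov_family (R : realType) (d : measure_display)
    (Omega : measurableType d)
    (k : R -> R -> \bar R -> probability (\bar R) R)
    (P : R -> \bar R -> probability Omega R) (Z : R -> Omega -> \bar R) : Prop :=
  [/\ forall t, 0 <= t -> measurable_fun setT (Z t),
      forall s (x : \bar R), 0 <= s -> (0 <= x)%E ->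
        P s x [set w | Z s w = x] = 1%E
    & forall s t u (x : \bar R) (A : set Omega) (B : set (\bar R)),
        0 <= s <= t -> t <= u -> (0 <= x)%E ->
        <<s past_generators Z s t >> A -> measurable B ->
        P s x (A `&` Z u @^-1` B) = (\int[P s x]_(w in A) k t u (Z t w) B)%E].

Definition branching_process (R : realType) (d : measure_display)
    (Omega : measurableType d)
    (k : R -> R -> \bar R -> probability (\bar R) R)
    (P : R -> \bar R -> probability Omega R) (Z : R -> Omega -> \bar R) : Prop :=
  branching_kernels k /\ markov_family k P Z.

(* Main.v *)
(** All four conditions say that [theta <= v s t theta] for every [theta > 0].
    A Chernoff bound turns this inequality into [x <= Z t] almost surely, and
    conversely; the Markov property at rational levels then gives (b).  If the
    Denjoy--Wolff point of [v s t] is infinity, then [v s t theta < theta] is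
    impossible, since the orbit of [theta] would stay in the interval from [0] to
    [theta].

    For the converse implication towards (a), the rescaled laws
    [m k_{s,t}(1/m, dy)] have a limit [L] along an ultrafilter, a positive linear
    functional on functions dominated by [1 - exp(-y)], with
    [v theta = q + L(1 - exp(-theta y))].  Differentiating under [L], with
    remainders bounded uniformly by [C h^2 (1 - exp(-y))], shows that [v] is
    Bernstein and that [F zeta = q + L(1 - exp(-zeta y))] is holomorphic, with
    [Re (F zeta) >= v (Re zeta)].  Finally [v theta - theta] is nondecreasing,
    because [exp(-x (v theta - theta))] is the Laplace transform of
    [Z t - x >= 0], and [v (n theta) <= n v theta] shows that it vanishes
    nowhere unless [v] is the identity.  Hence [Re (F^n zeta)] grows at least
    linearly in [n], uniformly on compact sets. *)

Require Import Defs.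
From HB Require Import structures.
From mathcomp Require Import all_boot all_order all_algebra.
From mathcomp Require Import all_classical all_reals all_analysis.
From mathcomp Require Import measurable_realfun.
From mathcomp.real_closed Require Import complex.
From mathcomp Require Import ring lra.
Import Order.TTheory GRing.Theory Num.Theory.
Import numFieldNormedType.Exports.
Local Open Scope classical_set_scope.
Local Open Scope ring_scope.
Local Open Scope complex_scope.

(** * Elementary bounds on the exponential, sine and cosine *)

Section elementary_bounds.
Context {R : realType}.
Implicit Types (u y c : R).

Let sqr_normr u : `|u| ^+ 2 = u ^+ 2.
Proof. by rewrite real_normK ?num_real. Qed.

(** This is [1 - u <= expR (- u)] multiplied by [expR u]. *)
Lemma expR_sub1_le u : expR u - 1 <= u * expR u.
Proof.
have := expR_ge1Dx (- u); rewrite -(ler_pM2r (expR_gt0 u)) -expRD addNr expR0.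
lra.
Qed.

Lemma normr_expR_sub1_le u : `|expR u - 1| <= `|u| * expR `|u|.
Proof.
have h1 := expR_ge1Dx u; have h2 := expR_sub1_le u.
have [u0|u0] := leP 0 u.
  rewrite (ger0_norm u0) ger0_norm; lra.
have e1 : expR u <= 1 by rewrite -expR0 ler_expR ltW.
have e2 : 1 <= expR (- u) by rewrite -expR0 ler_expR; lra.
rewrite ler0_norm; last lra.
rewrite (ltr0_norm u0); apply: (@le_trans _ _ (- u)); first lra.
by rewrite ler_peMr//; lra.
Qed.

(** The remainder is nonnegative and at most [u * (expR u - 1)], to which the first-order bound
    applies. *)
Lemma expR_taylor1_le u : `|expR u - 1 - u| <= u ^+ 2 * expR `|u|.
Proof.
have h1 := expR_ge1Dx u; have h2 := expR_sub1_le u.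
rewrite ger0_norm; last lra.
apply: (@le_trans _ _ (u * (expR u - 1))); first lra.
apply: le_trans (ler_norm _) _.
by rewrite normrM -(sqr_normr u) expr2 -mulrA ler_wpM2l// normr_expR_sub1_le.
Qed.

Lemma normr_sin_le u : `|sin u| <= `|u|.
Proof.
have H (z : R) : 0 <= z -> `|sin z| <= z.
  move=> z0.
  have [//|z' _] := @MVT_segment R sin cos 0 z z0 (fun z _ => is_derive_sin z).
    by apply: continuous_subspaceT => x; exact: continuous_sin.
  rewrite sin0 !subr0 => ->; rewrite normrM (ger0_norm z0) ler_piMl//.
  by rewrite ler_norml cos_geN1 cos_le1.
have [u0|u0] := leP 0 u; first by rewrite (ger0_norm u0) H.
by rewrite -[`|sin u|]normrN -sinN (ltr0_norm u0); apply: H; lra.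
Qed.

Lemma cos_sub1 u : cos u - 1 = - (2 * sin (u / 2) ^+ 2).
Proof.
have {1}-> : u = u / 2 + u / 2 by field.
rewrite cosD -!expr2; have := cos2Dsin2 (u / 2); lra.
Qed.

Lemma normr_cos_sub1_le u : `|cos u - 1| <= u ^+ 2.
Proof.
rewrite cos_sub1 normrN ger0_norm; last by rewrite mulr_ge0// sqr_ge0.
have : sin (u / 2) ^+ 2 <= (u / 2) ^+ 2.
  by rewrite -(sqr_normr (sin _)) -(sqr_normr (u / 2)) lerXn2r ?nnegrE// normr_sin_le.
have := sqr_ge0 u; rewrite expr_div_n; lra.
Qed.

Lemma normr_cos_sub1_le_norm u : `|cos u - 1| <= `|u|.
Proof.
have [u1|u1] := leP `|u| 1.
  apply: (le_trans (normr_cos_sub1_le _)).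
  by rewrite -sqr_normr expr2 ler_piMl.
rewrite cos_sub1 normrN ger0_norm; last by rewrite mulr_ge0// sqr_ge0.
have s1 : `|sin (u / 2)| <= 1 by rewrite ler_norml sin_geN1 sin_le1.
have := normr_sin_le (u / 2); rewrite normrM [`|2^-1|]ger0_norm//.
have := normr_ge0 (sin (u / 2)).
rewrite -sqr_normr; nra.
Qed.

Lemma normr_sin_subid_le u : `|sin u - u| <= u ^+ 2.
Proof.
have H (z : R) : 0 <= z -> `|sin z - z| <= z ^+ 2.
  move=> z0.
  have hd (x : R) : x \in `]0, z[%R ->
      is_derive x 1 (fun x => sin x - x) (cos x - 1).
    by move=> _; apply: is_deriveB.
  have [//|x /[!in_itv]/= /andP[x0 xz]] := MVT_segment z0 hd.
    apply: continuous_subspaceT => x; apply: continuousB => //.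
    exact: continuous_sin.
  rewrite sin0 !subr0 => ->; rewrite normrM (ger0_norm z0) expr2 ler_wpM2r//.
  by rewrite (le_trans (normr_cos_sub1_le_norm _))// ger0_norm.
have [u0|u0] := leP 0 u; first exact: H.
have -> : sin u - u = - (sin (- u) - (- u)) by rewrite sinN; lra.
by rewrite normrN -sqrrN; apply: H; lra.
Qed.

(** A single term of the exponential series, [(c * y) ^+ n / n!], is already at most
    [expR (c * y)]. *)
Lemma exprn_expR_bounded (n : nat) c : 0 < c ->
  exists2 C, 0 <= C & forall y, 0 <= y -> y ^+ n * expR (- (c * y)) <= C.
Proof.
move=> c0; case: n => [|n].
  exists 1 => // y y0; rewrite expr0 mul1r -expR0 ler_expR.
  by rewrite oppr_le0 mulr_ge0// ltW.
exists (n.+1`!%:R / c ^+ n.+1); first by rewrite divr_ge0// exprn_ge0// ltW.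
move=> y y0; have cy0 : 0 <= c * y by rewrite mulr_ge0// ltW.
rewrite expRN ler_pdivrMr ?expR_gt0//.
have := expR_ge1Dxn n cy0; rewrite exprMn => h.
rewrite mulrAC ler_pdivlMr ?exprn_gt0// mulrC.
rewrite [leRHS]mulrC -ler_pdivrMr ?ltr0n ?fact_gt0//; lra.
Qed.

(** A form of Bernoulli's inequality. With [z] an exponential it compares the Laplace weights at
    [n * theta] and at [theta]. *)
Lemma sub1_exprn_le (n : nat) (z : R) : 0 <= z -> z <= 1 ->
  1 - z ^+ n <= n%:R * (1 - z).
Proof.
move=> z0 z1; elim: n => [|n IH]; first by rewrite expr0; lra.
rewrite exprS mulrS.
have zn1 : z ^+ n <= 1 by rewrite exprn_ile1.
have : 0 <= z ^+ n by rewrite exprn_ge0.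
nra.
Qed.

(** Comparable with [min(1, y)] on the half-line, the usual integrability weight of Levy
    measures. *)
Definition weight y : R := 1 - expR (- y).

Lemma weight_ge0 y : 0 <= y -> 0 <= weight y.
Proof. by move=> y0; rewrite /weight subr_ge0 -expR0 ler_expR; lra. Qed.

(** Since [y <= (1 + y) * weight y], one of the [n.+1] factors [y] is traded for [weight y]; the
    exponential bounds the remaining polynomial [y ^+ n * (1 + y)]. *)
Lemma exprSn_expR_le_weight (n : nat) c : 0 < c ->
  exists2 C, 0 <= C &
    forall y, 0 <= y -> y ^+ n.+1 * expR (- (c * y)) <= C * weight y.
Proof.
move=> c0.
have [C1 C10 h1] := exprn_expR_bounded n _ c0.
have [C2 C20 h2] := exprn_expR_bounded n.+1 _ c0.
exists (C1 + C2); first by rewrite addr_ge0.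
move=> y y0.
have hw : y <= (1 + y) * weight y.
  rewrite /weight mulrBr mulr1 expRN lerBrDr -lerBrDl addrK.
  by rewrite ler_pdivrMr ?expR_gt0// mul1r expR_ge1Dx.
have hE : y ^+ n * expR (- (c * y)) + y ^+ n.+1 * expR (- (c * y)) <= C1 + C2.
  by rewrite lerD// ?h1// h2.
have Y0 : 0 <= y ^+ n * expR (- (c * y)) by rewrite mulr_ge0 ?exprn_ge0 ?expR_ge0.
apply: (@le_trans _ _ (y ^+ n * expR (- (c * y)) * ((1 + y) * weight y))).
  by rewrite exprSr -!mulrA ler_wpM2l ?exprn_ge0// mulrC ler_wpM2l ?expR_ge0.
rewrite mulrA ler_wpM2r ?weight_ge0//; move: hE; rewrite exprSr; lra.
Qed.

Lemma weight_le1 y : weight y <= 1.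
Proof. by rewrite /weight gerBl expR_ge0. Qed.

End elementary_bounds.

(** * The Levy functional as a limit of rescaled laws *)

Section levy_functional.
Context {R : realType}.

(** Domination by [weight] keeps the rescaled means of [phi] bounded along the sequence of laws.
    Negative arguments are unconstrained, the laws being integrated over [[0, +oo)] only. *)
Definition tame (phi : R -> R) : Prop :=
  measurable_fun setT phi /\
  exists2 C : R, 0 <= C & forall y, 0 <= y -> `|phi y| <= C * weight y.

Lemma tameD (phi psi : R -> R) : tame phi -> tame psi ->
  tame (fun y => phi y + psi y).
Proof.
move=> [m1 [C1 C10 h1]] [m2 [C2 C20 h2]]; split; first exact: measurable_funD.
exists (C1 + C2); first exact: addr_ge0.
move=> y y0; rewrite mulrDl (le_trans (ler_normD _ _))// lerD ?h1 ?h2//.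
Qed.

Lemma tameZ (c : R) (phi : R -> R) : tame phi -> tame (fun y => c * phi y).
Proof.
move=> [m1 [C1 C10 h1]]; split; first exact: measurable_funM.
exists (`|c| * C1); first by rewrite mulr_ge0.
by move=> y y0; rewrite normrM -mulrA ler_wpM2l// h1.
Qed.

Lemma tameB (phi psi : R -> R) : tame phi -> tame psi ->
  tame (fun y => phi y - psi y).
Proof.
move=> h1 h2; have -> : (fun y => phi y - psi y) = (fun y => phi y + -1 * psi y).
  by apply/funext => y; rewrite mulN1r.
by apply: tameD => //; exact: tameZ.
Qed.

Local Notation Efin := [set y : \bar R | (0 <= y < +oo)%E].

Lemma measurable_Efin : measurable Efin.
Proof.
rewrite (_ : Efin = [set` Interval (BLeft 0%E) (BLeft +oo%E)]); last first.
  by apply/seteqP; split => y /=; rewrite in_itv.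
exact: emeasurable_itv.
Qed.

(** The mass at [+oo] is left out, as in the Laplace transform, so the mean of the constant 1 may
    fall short of 1; the rescaled deficit is the source of the constant [q]. *)
Definition fin_mean (mu : probability (\bar R) R) (phi : R -> R) : R :=
  \int[mu]_(y in Efin) phi (fine y).

Definition bounded_meas (phi : R -> R) : Prop :=
  measurable_fun setT phi /\ exists C : R, forall y, 0 <= y -> `|phi y| <= C.

Lemma tame_bounded (phi : R -> R) : tame phi -> bounded_meas phi.
Proof.
move=> [m1 [C C0 h]]; split => //; exists C => y y0.
by rewrite (le_trans (h _ y0))// ler_piMr// weight_le1.
Qed.

Lemma bounded_measZ (c : R) (phi : R -> R) :
  bounded_meas phi -> bounded_meas (fun y => c * phi y).
Proof.
move=> [mphi [C hC]]; split; first exact: measurable_funM.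
by exists (`|c| * C) => y y0; rewrite normrM ler_wpM2l// hC.
Qed.

Section fin_mean.
Variable mu : probability (\bar R) R.

Lemma fin_mean_integrable (phi : R -> R) : bounded_meas phi ->
  mu.-integrable Efin (EFin \o (fun y => phi (fine y))).
Proof.
move=> [mphi [C h]]; apply: measurable_bounded_integrable.
- exact: measurable_Efin.
- by rewrite (le_lt_trans (probability_le1 _ _)) ?ltry//; exact: measurable_Efin.
- apply: (measurableT_comp mphi); apply: fine_measurable.
  exact: measurable_Efin.
- exists C; split; first exact: num_real.
  move=> M CM y /andP[y0 _]; apply: le_trans (ltW CM).
  by apply: h; rewrite fine_ge0.
Qed.

Lemma fin_meanD (phi psi : R -> R) : bounded_meas phi -> bounded_meas psi ->
  fin_mean mu (fun y => phi y + psi y) = fin_mean mu phi + fin_mean mu psi.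
Proof.
move=> h1 h2; rewrite /fin_mean RintegralD//.
- exact: measurable_Efin.
- exact: fin_mean_integrable.
- exact: fin_mean_integrable.
Qed.

Lemma fin_meanZ (c : R) (phi : R -> R) : bounded_meas phi ->
  fin_mean mu (fun y => c * phi y) = c * fin_mean mu phi.
Proof.
move=> h1; rewrite /fin_mean RintegralZl//.
- exact: measurable_Efin.
- exact: fin_mean_integrable.
Qed.

Lemma fin_mean_le (phi psi : R -> R) : bounded_meas phi -> bounded_meas psi ->
  (forall y, 0 <= y -> phi y <= psi y) -> fin_mean mu phi <= fin_mean mu psi.
Proof.
move=> h1 h2 h; apply: le_Rintegral.
- exact: measurable_Efin.
- exact: fin_mean_integrable.
- exact: fin_mean_integrable.
- by move=> y /andP[y0 _]; apply: h; rewrite fine_ge0.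
Qed.

Lemma bounded_meas_cst (c : R) : bounded_meas (fun=> c).
Proof. by split; [exact: measurable_cst|exists `|c|]. Qed.

Lemma fin_mean1 : 0 <= fin_mean mu (fun=> 1) <= 1.
Proof.
rewrite /fin_mean Rintegral_cst; last exact: measurable_Efin.
rewrite mul1r fine_ge0//=.
rewrite -lee_fin fineK ?probability_le1//; last exact: fin_num_measure measurable_Efin.
exact: measurable_Efin.
Qed.

End fin_mean.

Lemma measurable_expRZ (c : R) : measurable_fun setT (fun y : R => expR (- (c * y))).
Proof.
apply: continuous_measurable_fun => y.
apply: (@continuous_comp _ _ _ (fun y => - (c * y)) expR).
  by apply: continuousN; apply: continuousM => //; exact: cst_continuous.
exact: continuous_expR.
Qed.

Lemma bounded_meas_expR (theta : R) : 0 <= theta ->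
  bounded_meas (fun y => expR (- (theta * y))).
Proof.
move=> t0; split; first exact: measurable_expRZ.
exists 1 => y y0; rewrite ger0_norm ?expR_ge0// -expR0 ler_expR.
by rewrite oppr_le0 mulr_ge0.
Qed.

(** The image of [U] has a cluster point in the compact segment from [- B] to [B], and an
    ultrafilter converges to each of its cluster points. *)
Lemma ultra_bounded_cvg (U : set_system nat) (a : nat -> R) (B : R) :
  UltraFilter U -> (forall n, `|a n| <= B) -> exists l : R, a n @[n --> U] --> l.
Proof.
move=> UU aB.
have UB : (a n @[n --> U]) `[- B, B]%classic.
  by apply: (@filterE _ U) => n /=; rewrite in_itv/= -ler_norml.
have [l [_ hl]] := @segment_compact R (- B) B _ (fmap_proper_filter a _) UB.
exists l => V Vl.
have [//|UV] := in_ultra_setVsetC (a @^-1` V) UU.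
by have [x [/= h1 /h1]] := hl (~` V) V UV Vl.
Qed.

Lemma tame_weight : tame weight.
Proof.
split; last by exists 1 => // y y0; rewrite mul1r ger0_norm ?weight_ge0.
rewrite /weight; apply: measurable_funB => //.
have [h _] := @bounded_meas_expR 1 ler01.
by under eq_fun do rewrite -[y in - y]mul1r.
Qed.

(** An abstract Levy-Khintchine formula with killing term [q]. The laws of [L] are required on tame
    functions only, because elsewhere the limit defining [L] need not exist. *)
Definition levy_rep (f : R -> R) (q : R) (L : (R -> R) -> R) : Prop :=
  [/\ 0 <= q,
      forall phi psi, tame phi -> tame psi ->
        L (fun y => phi y + psi y) = L phi + L psi,
      forall c phi, tame phi -> L (fun y => c * phi y) = c * L phi,
      forall phi, tame phi -> (forall y, 0 <= y -> 0 <= phi y) -> 0 <= L phi &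
      forall theta, 0 < theta ->
        f theta = q + L (fun y => 1 - expR (- (theta * y)))].

(** For an integer [n >= theta] the function is at most [1 - expR (- y) ^+ n], hence at most
    [n%:R * weight y]. *)
Lemma weight_scale_tame (theta : R) : 0 < theta ->
  tame (fun y => 1 - expR (- (theta * y))).
Proof.
move=> t0; split.
  apply: measurable_funB => //.
  by have [] := bounded_meas_expR theta (ltW t0).
have [n tn] : exists n : nat, theta <= n%:R.
  by exists (Num.trunc theta).+1; rewrite ltW// truncnS_gt.
exists n%:R => // y y0.
have ty : 0 <= theta * y by rewrite mulr_ge0// ltW.
rewrite ger0_norm ?(weight_ge0 (theta * y))//.
have e0 := expR_ge0 (- y).
apply: (@le_trans _ _ (1 - expR (- y) ^+ n)).
  by rewrite lerB// -expRM_natl ler_expR mulrN lerN2 ler_wpM2r.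
have e1 : expR (- y) <= 1 by rewrite -expR0 ler_expR oppr_le0.
exact: sub1_exprn_le.
Qed.

(* [L] is the limit of [phi |-> (m + 1) \int phi d(mu m)] along a fixed
   ultrafilter, so that no vague convergence has to be established; it stands for
   integration against the drift and Levy measure of [f]. *)
Lemma levy_rep_exists (mu : nat -> probability (\bar R) R) (f : R -> R) :
  (forall m theta, 0 < theta ->
     (\int[mu m]_(y in Efin)
        (expR (- theta * fine y))%:E)%E
     = (expR (- m.+1%:R^-1 * f theta))%:E) ->
  exists q L, levy_rep f q L.
Proof.
move=> hmu.
have [U [UU sU]] := ultraFilterLemma (@eventually_filter).
pose T m phi := m.+1%:R * fin_mean (mu m) phi.
have Texp m theta : 0 < theta ->
    fin_mean (mu m) (fun y => expR (- (theta * y))) =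
    expR (- (m.+1%:R^-1 * f theta)).
  move=> t0; rewrite /fin_mean /Rintegral.
  under eq_integral do rewrite -mulNr.
  by rewrite hmu//= mulNr.
(* Rescaled mass outside [[0, +oo)]; its limit is [q]. *)
pose kap m := m.+1%:R * (1 - fin_mean (mu m) (fun=> 1)).
(* The representation already holds exactly for each [m], with the right-hand side in place of
   [f theta], to which it converges. *)
have T1 m theta : 0 < theta ->
    kap m + T m (fun y => 1 - expR (- (theta * y))) =
    m.+1%:R * (1 - expR (- (m.+1%:R^-1 * f theta))).
  move=> t0; rewrite /T /kap -mulrDr -Texp//; congr (_ * _).
  have bE := bounded_meas_expR theta (ltW t0).
  under [fun y => 1 - _]eq_fun do rewrite -mulN1r.
  rewrite fin_meanD//; last 2 first.
  - exact: bounded_meas_cst.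
  - split; first by apply: measurable_funM => //; case: bE.
    by case: bE => _ [C hC]; exists C => y y0; rewrite mulN1r normrN hC.
  rewrite fin_meanZ//; lra.
have T1f m theta : 0 < theta ->
    m.+1%:R * (1 - expR (- (m.+1%:R^-1 * f theta))) <= f theta.
  move=> t0; have := expR_ge1Dx (- (m.+1%:R^-1 * f theta)) => h.
  rewrite -ler_pdivlMl ?ltr0n//.
  by move: (_ * f theta) h => z; lra.
have kap0 m : 0 <= kap m.
  by rewrite mulr_ge0// subr_ge0; have /andP[] := fin_mean1 (mu m).
have wE : weight = (fun y : R => 1 - expR (- (1 * y))).
  by apply/funext => y; rewrite mul1r.
have Tle m phi psi : tame phi -> tame psi ->
    (forall y, 0 <= y -> phi y <= psi y) -> T m phi <= T m psi.
  by move=> h1 h2 h; rewrite ler_wpM2l// fin_mean_le//; exact: tame_bounded.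
have TD m phi psi : tame phi -> tame psi ->
    T m (fun y => phi y + psi y) = T m phi + T m psi.
  by move=> h1 h2; rewrite /T fin_meanD ?mulrDr//; exact: tame_bounded.
have TZ m c phi : tame phi -> T m (fun y => c * phi y) = c * T m phi.
  by move=> h1; rewrite /T fin_meanZ 1?mulrCA//; exact: tame_bounded.
have Tw m : 0 <= T m weight <= f 1.
  apply/andP; split.
    rewrite mulr_ge0// /fin_mean Rintegral_ge0// => y /andP[y0 _].
    by rewrite weight_ge0// fine_ge0.
  by rewrite (le_trans _ (T1f m 1 ltr01))// -T1// -wE lerDr.
(* [T m phi] is controlled by [C * T m weight], and [T m weight] by [f 1], uniformly in [m]. *)
have Tcvg phi : tame phi -> exists l : R, T m phi @[m --> U] --> l.
  move=> tphi; have [_ [C C0 hC]] := tphi.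
  apply: (@ultra_bounded_cvg U (T^~ phi) (C * f 1) UU) => m.
  have /andP[w0 w1] := Tw m.
  apply: (@le_trans _ _ (C * T m weight)); last by rewrite ler_wpM2l.
  have tw := tame_weight.
  rewrite ler_norml -mulNr -!TZ// !Tle//; do ?exact: tameZ.
  - by move=> y /hC; rewrite ler_norml => /andP[].
  - by move=> y /hC; rewrite ler_norml mulNr => /andP[].
have [q hq] : exists q : R, kap m @[m --> U] --> q.
  apply: (@ultra_bounded_cvg U kap (f 1) UU) => m.
  have /andP[w0 _] := Tw m.
  by rewrite ger0_norm// (le_trans _ (T1f m 1 ltr01))// -T1// -wE lerDl.
have Hlim phi l : T m phi @[m --> U] --> l -> lim (T m phi @[m --> U]) = l.
  by move=> /cvg_lim; apply; exact: Rhausdorff.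
exists q, (fun phi => lim (T m phi @[m --> U])); split.
- rewrite -(cvg_lim (@Rhausdorff R) hq); apply: limr_ge.
    by apply/cvg_ex; exists q.
  exact: filterE.
- move=> phi psi h1 h2.
  have [l1 c1] := Tcvg _ h1; have [l2 c2] := Tcvg _ h2.
  rewrite (Hlim _ _ c1) (Hlim _ _ c2); apply: Hlim.
  under eq_fun do rewrite TD//.
  exact: cvgD.
- move=> c phi h1; have [l1 c1] := Tcvg _ h1.
  rewrite (Hlim _ _ c1); apply: Hlim.
  under eq_fun do rewrite TZ//.
  by apply: cvgM => //; exact: cvg_cst.
- move=> phi h1 h; have [l1 c1] := Tcvg _ h1.
  apply: limr_ge; first by apply/cvg_ex; exists l1.
  apply: filterE => m /=.
  rewrite mulr_ge0// /fin_mean Rintegral_ge0// => y /andP[y0 _].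
  by apply: h; rewrite fine_ge0.
- move=> theta t0; have [l1 c1] := Tcvg _ (weight_scale_tame _ t0).
  rewrite (Hlim _ _ c1).
  have c2 : kap m + T m (fun y => 1 - expR (- (theta * y))) @[m --> U]
      --> q + l1 by exact: cvgD.
  have c3 : kap m + T m (fun y => 1 - expR (- (theta * y))) @[m --> U]
      --> f theta.
    (* Convergence along [\oo] passes to the finer filter [U]. *)
    suff h : kap m + T m (fun y => 1 - expR (- (theta * y))) @[m --> \oo]
        --> f theta by move=> V /h; exact: sU.
    under eq_fun do rewrite T1//.
    (* Lower barrier from the second-order Taylor bound at [- (f theta / (m + 1))]; [harmonic m] is
       [1 / (m + 1)]. *)
    pose lo (m : nat) := f theta - f theta ^+ 2 * expR `|f theta| * harmonic m.
    apply: (@squeeze_cvgr _ _ _ _ lo (fun=> f theta)).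
    + apply: filterE => m /=; rewrite T1f// andbT /lo /harmonic/=.
      set x := m.+1%:R^-1 : R.
      have x0 : 0 < x by rewrite invr_gt0.
      have x1 : x <= 1 by rewrite invf_le1// ler1n.
      have -> : m.+1%:R = x^-1 by rewrite invrK.
      rewrite [leRHS]mulrC ler_pdivlMr//.
      have := expR_taylor1_le (- (x * f theta)).
      move=> /(le_trans (ler_norm _)); rewrite sqrrN exprMn normrN => h.
      have h2 : expR `|x * f theta| <= expR `|f theta|.
        by rewrite ler_expR normrM ger0_norm ?ler_piMl// ltW.
      have h3 : x ^+ 2 * f theta ^+ 2 * expR `|x * f theta| <=
                x ^+ 2 * f theta ^+ 2 * expR `|f theta|.
        by rewrite ler_wpM2l// mulr_ge0// sqr_ge0.
      lra.
    + rewrite -[X in _ --> X]subr0 -[in X in _ - X](mulr0 (f theta ^+ 2 * expR `|f theta|)).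
      apply: cvgB; first exact: cvg_cst.
      by apply: cvgM; [exact: cvg_cst|exact: cvg_harmonic].
    + exact: cvg_cst.
  exact: (cvg_unique _ c3 c2).
Qed.

End levy_functional.

(** * Derivatives obtained from quadratic remainders *)

Section quadratic_remainder.
Context {K : numFieldType}.

(** The difference quotient differs from [D] by at most [C * |h|]. Stating it over any
    [numFieldType] covers both the real derivatives of [f] and the complex derivative of its
    extension. *)
Lemma is_derive_quadratic (F : K^o -> K^o) (z D : K) (C delta : K) :
  0 < delta -> 0 <= C ->
  (forall h : K, `|h| < delta -> `|F (z + h) - F z - h * D| <= C * `|h| ^+ 2) ->
  is_derive (z : K^o) (1 : K^o) F D.
Proof.
move=> delta0 C0 hF.
suff H : h^-1 *: (F (h *: (1 : K^o) + z) - F z) @[h --> (0 : K)^'] --> (D : K^o).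
  apply: DeriveDef; first by apply/cvg_ex; exists D.
  exact: (cvg_lim (@norm_hausdorff _ _) H).
apply/cvgrPdist_le => e e0; near=> h.
have h0 : h != 0 by near: h; exact: nbhs_dnbhs_neq.
have hd : `|h| < delta by near: h; exact: dnbhs0_lt.
(* Dividing by [C + 1] avoids the case [C = 0]. *)
have he : `|h| < e / (C + 1).
  by near: h; apply: dnbhs0_lt; rewrite divr_gt0// ltr_wpDl.
have -> : D - h^-1 *: (F (h *: (1 : K^o) + z) - F z) =
    - (h^-1 * (F (z + h) - F z - h * D)).
  by rewrite [in RHS]mulrBr mulKf// opprB /GRing.scale/= mulr1 (addrC h z).
rewrite normrN normrM normfV ler_pdivrMl ?normr_gt0//.
apply: (le_trans (hF _ hd)); rewrite expr2 mulrA mulrC ler_wpM2l//.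
apply: (@le_trans _ _ ((C + 1) * `|h|)); first by rewrite ler_wpM2r// lerDl.
by rewrite mulrC -ler_pdivlMr ?ltr_wpDl// ltW.
Unshelve. all: by end_near. Qed.

End quadratic_remainder.

(** * Tame functions and their second-order expansions, uniform in [y] *)

Section tame_functions.
Context {R : realType}.

Lemma measurable_cosZ (c : R) : measurable_fun setT (fun y : R => cos (c * y)).
Proof.
apply: continuous_measurable_fun => y.
apply: (@continuous_comp _ _ _ (fun y => c * y) cos).
  by apply: continuousM => //; exact: cst_continuous.
exact: continuous_cos.
Qed.

Lemma measurable_sinZ (c : R) : measurable_fun setT (fun y : R => sin (c * y)).
Proof.
apply: continuous_measurable_fun => y.
apply: (@continuous_comp _ _ _ (fun y => c * y) sin).
  by apply: continuousM => //; exact: cst_continuous.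
exact: continuous_sin.
Qed.

Lemma measurable_pow_expR (n : nat) (c : R) :
  measurable_fun setT (fun y : R => y ^+ n * expR (- (c * y))).
Proof.
apply: measurable_funM; last exact: measurable_expRZ.
exact: measurable_funX.
Qed.

(** At least one factor [y] is required, since [weight] vanishes to first order at 0. *)
Lemma tame_of_bound (n : nat) (c B : R) (phi : R -> R) : 0 < c -> 0 <= B ->
  measurable_fun setT phi ->
  (forall y, 0 <= y -> `|phi y| <= B * (y ^+ n.+1 * expR (- (c * y)))) ->
  tame phi.
Proof.
move=> c0 B0 mphi hphi; split => //.
have [C C0 hC] := exprSn_expR_le_weight n c c0.
exists (B * C); first exact: mulr_ge0.
by move=> y y0; rewrite (le_trans (hphi _ y0))// -mulrA ler_wpM2l// hC.
Qed.

Definition moment_fun (n : nat) (theta y : R) : R := y ^+ n * expR (- (theta * y)).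

Lemma tame_moment n theta : 0 < theta -> tame (moment_fun n.+1 theta).
Proof.
move=> t0; apply: (@tame_of_bound n theta 1) => //.
  exact: measurable_pow_expR.
by move=> y y0; rewrite mul1r ger0_norm// mulr_ge0 ?exprn_ge0 ?expR_ge0.
Qed.

(* Real and imaginary parts of [1 - exp(-(s + i t) y)], and of its derivative
   [y exp(-(s + i t) y)] up to the sign of the imaginary part. *)
Definition re_fun (s t y : R) : R := 1 - expR (- (s * y)) * cos (t * y).
Definition im_fun (s t y : R) : R := expR (- (s * y)) * sin (t * y).
Definition dre_fun (s t y : R) : R := y ^+ 1 * expR (- (s * y)) * cos (t * y).
Definition dim_fun (s t y : R) : R := y ^+ 1 * expR (- (s * y)) * sin (t * y).

Let cos_bnd (u : R) : `|cos u| <= 1.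
Proof. by rewrite ler_norml cos_geN1 cos_le1. Qed.

Let sin_bnd (u : R) : `|sin u| <= 1.
Proof. by rewrite ler_norml sin_geN1 sin_le1. Qed.

Lemma tame_im (s t : R) : 0 < s -> tame (im_fun s t).
Proof.
move=> s0; apply: (@tame_of_bound 0 s `|t|) => //.
  by apply: measurable_funM; [exact: measurable_expRZ|exact: measurable_sinZ].
move=> y y0; rewrite normrM ger0_norm ?expR_ge0// expr1 mulrA mulrC.
rewrite ler_wpM2r ?expR_ge0// (le_trans (normr_sin_le _))//.
by rewrite normrM (ger0_norm y0).
Qed.

Lemma tame_re (s t : R) : 0 < s -> tame (re_fun s t).
Proof.
move=> s0.
(* The first summand is a scaled weight; the second carries the factor [1 - cos], which is quadratic
   in [y]. *)
have -> : re_fun s t = (fun y => (1 - expR (- (s * y))) +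
    expR (- (s * y)) * (1 - cos (t * y))).
  by apply/funext => y; rewrite /re_fun; ring.
apply: tameD; first exact: weight_scale_tame.
apply: (@tame_of_bound 1 s (t ^+ 2)) => //.
- by rewrite sqr_ge0.
- apply: measurable_funM; first exact: measurable_expRZ.
  by apply: measurable_funB => //; exact: measurable_cosZ.
move=> y y0; rewrite normrM ger0_norm ?expR_ge0// mulrA mulrC.
rewrite ler_wpM2r ?expR_ge0// distrC (le_trans (normr_cos_sub1_le _))//.
by rewrite exprMn.
Qed.

Lemma tame_dre (s t : R) : 0 < s -> tame (dre_fun s t).
Proof.
move=> s0; apply: (@tame_of_bound 0 s 1) => //.
  by apply: measurable_funM; [exact: measurable_pow_expR|exact: measurable_cosZ].
move=> y y0; rewrite mul1r normrM ger0_norm; last first.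
  by rewrite mulr_ge0 ?expR_ge0.
by rewrite ler_piMr// mulr_ge0 ?expR_ge0.
Qed.

Lemma tame_dim (s t : R) : 0 < s -> tame (dim_fun s t).
Proof.
move=> s0; apply: (@tame_of_bound 0 s 1) => //.
  by apply: measurable_funM; [exact: measurable_pow_expR|exact: measurable_sinZ].
move=> y y0; rewrite mul1r normrM ger0_norm; last first.
  by rewrite mulr_ge0 ?expR_ge0.
by rewrite ler_piMr// mulr_ge0 ?expR_ge0.
Qed.

(** A perturbation of the exponent by at most [s / 2] uses up half of the decay; the other half
    remains to absorb powers of [y]. *)
Lemma expR_half_le (s a y : R) : `|a| <= s / 2 -> 0 <= y ->
  expR (- (s * y)) * expR (`|a| * y) <= expR (- (s / 2 * y)).
Proof.
move=> a2 y0; rewrite -expRD ler_expR.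
have : 0 <= (s / 2 - `|a|) * y by rewrite mulr_ge0// subr_ge0.
lra.
Qed.

(** Factoring out [y ^+ n * expR (- (theta * y))] leaves the second-order Taylor remainder of the
    exponential at [- (h * y)], which contributes two more powers of [y]. *)
Lemma moment_remainder (n : nat) (theta h y : R) : `|h| <= theta / 2 -> 0 <= y ->
  `|moment_fun n (theta + h) y - moment_fun n theta y + h * moment_fun n.+1 theta y|
   <= h ^+ 2 * (y ^+ n.+2 * expR (- (theta / 2 * y))).
Proof.
move=> h2 y0; rewrite /moment_fun.
have -> : y ^+ n * expR (- ((theta + h) * y)) - y ^+ n * expR (- (theta * y)) +
    h * (y ^+ n.+1 * expR (- (theta * y))) =
    y ^+ n * expR (- (theta * y)) * (expR (- (h * y)) - 1 - (- (h * y))).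
  have -> : expR (- ((theta + h) * y)) = expR (- (theta * y)) * expR (- (h * y)).
    by rewrite -expRD; congr expR; ring.
  by rewrite exprSr; ring.
have Y0 : 0 <= y ^+ n * expR (- (theta * y)) by rewrite mulr_ge0 ?exprn_ge0 ?expR_ge0.
rewrite normrM (ger0_norm Y0).
have := expR_taylor1_le (- (h * y)).
rewrite normrN normrM (ger0_norm y0) sqrrN => hT.
apply: (le_trans (ler_wpM2l Y0 hT)).
have -> : y ^+ n * expR (- (theta * y)) * ((h * y) ^+ 2 * expR (`|h| * y)) =
   (h ^+ 2 * y ^+ n.+2) * (expR (- (theta * y)) * expR (`|h| * y)).
  by rewrite (exprSr _ n.+1) (exprSr _ n); ring.
rewrite [leRHS]mulrA; apply: ler_wpM2l.
  by apply: mulr_ge0; [exact: sqr_ge0|exact: exprn_ge0].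
exact: expR_half_le.
Qed.

(** Real part of the second-order remainder of [exp(-(a + i b) y)]. *)
Lemma exp_cos_remainder (a b y : R) : 0 <= y ->
  `|expR (- (a * y)) * cos (b * y) - 1 + a * y| <=
  (a ^+ 2 + b ^+ 2) * y ^+ 2 * expR (`|a| * y).
Proof.
move=> y0.
have -> : expR (- (a * y)) * cos (b * y) - 1 + a * y =
  (expR (- (a * y)) - 1 - (- (a * y))) + expR (- (a * y)) * (cos (b * y) - 1).
  by ring.
apply: (le_trans (ler_normD _ _)).
have h1 := expR_taylor1_le (- (a * y)).
rewrite normrN (normrM a) (ger0_norm y0) sqrrN exprMn in h1.
have h2 := normr_cos_sub1_le (b * y); rewrite exprMn in h2.
have e1 : expR (- (a * y)) <= expR (`|a| * y).
  by rewrite ler_expR -mulNr ler_wpM2r// -normrN ler_norm.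
rewrite mulrDl mulrDl lerD// normrM (ger0_norm (expR_ge0 _)) mulrC.
by rewrite ler_pM// expR_ge0.
Qed.

(** Minus the imaginary part of the same remainder. *)
Lemma exp_sin_remainder (a b y : R) : 0 <= y ->
  `|expR (- (a * y)) * sin (b * y) - b * y| <=
  2 * (a ^+ 2 + b ^+ 2) * y ^+ 2 * expR (`|a| * y).
Proof.
move=> y0.
have -> : expR (- (a * y)) * sin (b * y) - b * y =
  (expR (- (a * y)) - 1) * sin (b * y) + (sin (b * y) - b * y).
  by ring.
apply: (le_trans (ler_normD _ _)).
have h1 := normr_expR_sub1_le (- (a * y)).
rewrite normrN (normrM a) (ger0_norm y0) in h1.
have h2 := normr_sin_subid_le (b * y); rewrite exprMn in h2.
have h3 := normr_sin_le (b * y); rewrite (normrM b) (ger0_norm y0) in h3.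
have e1 : 1 <= expR (`|a| * y) by rewrite -expR0 ler_expR mulr_ge0.
have h4 : `|(expR (- (a * y)) - 1) * sin (b * y)| <=
    (`|a| * y * expR (`|a| * y)) * (`|b| * y) by rewrite normrM ler_pM.
have h5 : b ^+ 2 * y ^+ 2 <= b ^+ 2 * y ^+ 2 * expR (`|a| * y).
  by rewrite ler_peMr//; apply: mulr_ge0; exact: sqr_ge0.
have h6 : `|a| * `|b| * (y ^+ 2 * expR (`|a| * y)) <=
    (a ^+ 2 + b ^+ 2) * (y ^+ 2 * expR (`|a| * y)).
  apply: ler_wpM2r; first by apply: mulr_ge0; [exact: sqr_ge0|exact: expR_ge0].
  rewrite -(real_normK (num_real a)) -(real_normK (num_real b)).
  have := sqr_ge0 (`|a| - `|b|); have := sqr_ge0 `|a|; have := sqr_ge0 `|b|.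
  nra.
have h7 : 0 <= a ^+ 2 * (y ^+ 2 * expR (`|a| * y)).
  by rewrite mulrA; do 2?apply: mulr_ge0; rewrite ?sqr_ge0 ?expR_ge0.
lra.
Qed.

(** The addition formulas reduce the remainder at [s + i t] to those at 0, called [r1] and [r2];
    their constants 1 and 2 add up to 3. *)
Lemma re_remainder (s t a b y : R) : `|a| <= s / 2 -> 0 <= y ->
  `|re_fun (s + a) (t + b) y - re_fun s t y -
    (a * dre_fun s t y + b * dim_fun s t y)| <=
  3 * (a ^+ 2 + b ^+ 2) * (y ^+ 2 * expR (- (s / 2 * y))).
Proof.
move=> a2 y0; rewrite /re_fun /dre_fun /dim_fun.
set r1 := expR (- (a * y)) * cos (b * y) - 1 + a * y.
set r2 := expR (- (a * y)) * sin (b * y) - b * y.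
rewrite (_ : _ - _ = - (expR (- (s * y)) * (cos (t * y) * r1 - sin (t * y) * r2))).
  rewrite normrN normrM (ger0_norm (expR_ge0 _)).
  have h1 := exp_cos_remainder a b y y0; have h2 := exp_sin_remainder a b y y0.
  have h : `|cos (t * y) * r1 - sin (t * y) * r2| <=
      3 * (a ^+ 2 + b ^+ 2) * y ^+ 2 * expR (`|a| * y).
    apply: (le_trans (ler_normB _ _)); rewrite !normrM.
    have := ler_piMl (normr_ge0 r1) (cos_bnd (t * y)).
    have := ler_piMl (normr_ge0 r2) (sin_bnd (t * y)).
    rewrite -/r1 -/r2 in h1 h2; lra.
  apply: (le_trans (ler_wpM2l (expR_ge0 _) h)).
  rewrite mulrCA [leRHS]mulrA; apply: ler_wpM2l; last exact: expR_half_le.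
  apply: mulr_ge0; last exact: sqr_ge0.
  by rewrite mulr_ge0// addr_ge0// sqr_ge0.
rewrite /r1 /r2 !mulrDl !opprD expRD cosD; ring.
Qed.

(** The linear terms here and in [re_remainder] are the two components of
    [(dre_fun - i dim_fun) * (a + i b)], which encodes the Cauchy-Riemann equations. *)
Lemma im_remainder (s t a b y : R) : `|a| <= s / 2 -> 0 <= y ->
  `|im_fun (s + a) (t + b) y - im_fun s t y -
    (b * dre_fun s t y - a * dim_fun s t y)| <=
  3 * (a ^+ 2 + b ^+ 2) * (y ^+ 2 * expR (- (s / 2 * y))).
Proof.
move=> a2 y0; rewrite /im_fun /dre_fun /dim_fun.
set r1 := expR (- (a * y)) * cos (b * y) - 1 + a * y.
set r2 := expR (- (a * y)) * sin (b * y) - b * y.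
rewrite (_ : _ - _ = expR (- (s * y)) * (sin (t * y) * r1 + cos (t * y) * r2)).
  rewrite normrM (ger0_norm (expR_ge0 _)).
  have h1 := exp_cos_remainder a b y y0; have h2 := exp_sin_remainder a b y y0.
  have h : `|sin (t * y) * r1 + cos (t * y) * r2| <=
      3 * (a ^+ 2 + b ^+ 2) * y ^+ 2 * expR (`|a| * y).
    apply: (le_trans (ler_normD _ _)); rewrite !normrM.
    have := ler_piMl (normr_ge0 r1) (sin_bnd (t * y)).
    have := ler_piMl (normr_ge0 r2) (cos_bnd (t * y)).
    rewrite -/r1 -/r2 in h1 h2; lra.
  apply: (le_trans (ler_wpM2l (expR_ge0 _) h)).
  rewrite mulrCA [leRHS]mulrA; apply: ler_wpM2l; last exact: expR_half_le.
  apply: mulr_ge0; last exact: sqr_ge0.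
  by rewrite mulr_ge0// addr_ge0// sqr_ge0.
rewrite /r1 /r2 !mulrDl !opprD expRD sinD; ring.
Qed.

End tame_functions.

(** * Differentiation under the functional and holomorphic extension *)

Lemma normc_le_ReIm (R : realType) (z : R[i]) : `|z| <= (`|complex.Re z| + `|complex.Im z|)%:C.
Proof.
case: z => a b; rewrite normc_def/= lecR.
rewrite -(@ger0_norm _ (`|a| + `|b|)) ?addr_ge0// -sqrtr_sqr ler_wsqrtr//.
rewrite sqrrD !real_normK ?num_real//.
have : 0 <= `|a| * `|b| by rewrite mulr_ge0.
lra.
Qed.

Section levy_representation.
Context {R : realType}.
Variables (f : R -> R) (q : R) (L : (R -> R) -> R).
Hypothesis Lrep : levy_rep f q L.

Lemma levyD phi psi : tame phi -> tame psi ->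
  L (fun y => phi y + psi y) = L phi + L psi.
Proof. by have [_ h _ _ _] := Lrep; exact: h. Qed.

Lemma levyZ c phi : tame phi -> L (fun y => c * phi y) = c * L phi.
Proof. by have [_ _ h _ _] := Lrep; exact: h. Qed.

Lemma levy_ge0 phi : tame phi -> (forall y, 0 <= y -> 0 <= phi y) -> 0 <= L phi.
Proof. by have [_ _ _ h _] := Lrep; exact: h. Qed.

Lemma levyB phi psi : tame phi -> tame psi ->
  L (fun y => phi y - psi y) = L phi - L psi.
Proof.
move=> h1 h2; have -> : (fun y => phi y - psi y) = (fun y => phi y + -1 * psi y).
  by apply/funext => y; rewrite mulN1r.
by rewrite levyD ?levyZ ?mulN1r//; exact: tameZ.
Qed.

Lemma levy_le phi psi : tame phi -> tame psi ->
  (forall y, 0 <= y -> phi y <= psi y) -> L phi <= L psi.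
Proof.
move=> h1 h2 h; rewrite -subr_ge0 -levyB//; apply: levy_ge0; first exact: tameB.
by move=> y y0; rewrite subr_ge0 h.
Qed.

Lemma levy_bound phi (B : R) : tame phi ->
  (forall y, 0 <= y -> `|phi y| <= B * weight y) -> `|L phi| <= B * L weight.
Proof.
move=> h1 h; have tw := @tame_weight R; have tB := tameZ B _ tw.
have tB' := tameZ (- B) _ tw.
rewrite ler_norml -mulNr -!levyZ//; apply/andP; split; apply: levy_le => // y y0;
  have := h y y0; rewrite ler_norml ?mulNr => /andP[]//.
Qed.

(** The constant depends on [n] and [c] alone, so with [e] of order [h ^+ 2] the functional turns
    pointwise remainders into one quadratic remainder. *)
Lemma levy_remainder n (c : R) : 0 < c -> exists2 B : R, 0 <= B &
  forall phi (e : R), 0 <= e -> tame phi ->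
  (forall y, 0 <= y -> `|phi y| <= e * (y ^+ n.+1 * expR (- (c * y)))) ->
  `|L phi| <= B * e.
Proof.
move=> c0; have [C C0 hC] := exprSn_expR_le_weight n c c0.
have Lw : 0 <= L weight by apply: levy_ge0; [exact: tame_weight|exact: weight_ge0].
exists (C * L weight); first exact: mulr_ge0.
move=> phi e e0 tphi hphi; rewrite mulrC mulrA; apply: levy_bound => // y y0.
by rewrite (le_trans (hphi _ y0))// -mulrA ler_wpM2l// hC.
Qed.

(** Up to the sign [(-1) ^+ n], the derivative of [f] of order [n.+1]. The shift to the power [n.+1]
    keeps the integrand tame. *)
Definition moment n theta := L (moment_fun n.+1 theta).

Lemma is_derive_moment n (theta : R) : 0 < theta ->
  is_derive theta 1 (moment n) (- moment n.+1 theta).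
Proof.
move=> t0; have t2 : 0 < theta / 2 by rewrite divr_gt0.
have [B B0 hB] := @levy_remainder n.+2 _ t2.
apply: (@is_derive_quadratic R (moment n) theta _ B (theta / 2)) => // h hh.
have th : 0 < theta + h by move: hh; rewrite ltr_norml => /andP[]; lra.
have t1 := tame_moment n _ t0; have t3 := tame_moment n _ th.
have t4 := tame_moment n.+1 _ t0.
rewrite mulrN opprK /moment -levyB// -levyZ// -levyD; last 2 first.
- exact: tameB.
- exact: tameZ.
rewrite real_normK ?num_real//; apply: hB.
- exact: sqr_ge0.
- by apply: tameD; [exact: tameB|exact: tameZ].
- by move=> y y0; apply: moment_remainder => //; exact: ltW.
Qed.

Lemma levy_repE (theta : R) : 0 < theta ->
  f theta = q + L (fun y => 1 - expR (- (theta * y))).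
Proof. by have [_ _ _ _ h] := Lrep; exact: h. Qed.

Lemma is_derive_levy_rep (theta : R) : 0 < theta ->
  is_derive theta 1 f (moment 0 theta).
Proof.
move=> t0; have t2 : 0 < theta / 2 by rewrite divr_gt0.
have [B B0 hB] := @levy_remainder 1 _ t2.
apply: (@is_derive_quadratic R f theta _ B (theta / 2)) => // h hh.
have th : 0 < theta + h by move: hh; rewrite ltr_norml => /andP[]; lra.
have t1 := weight_scale_tame _ t0; have t3 := weight_scale_tame _ th.
have t4 := tame_moment 0 _ t0.
rewrite !levy_repE// [q + _]addrC addrKA /moment -levyB// -levyZ// -levyB//; last 2 first.
- exact: tameB.
- exact: tameZ.
rewrite real_normK ?num_real//; apply: hB.
- exact: sqr_ge0.
- by apply: tameB; [exact: tameB|exact: tameZ].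
- move=> y y0; rewrite -normrN.
  have := moment_remainder 0 _ _ _ (ltW hh) y0; apply: le_trans.
  rewrite le_eqVlt; apply/orP; left; apply/eqP; congr (`| _ |).
  by rewrite /moment_fun expr0; ring.
Qed.

Lemma derive1n_levy_rep n (theta : R) : 0 < theta ->
  derive1n n.+1 f theta = (-1) ^+ n * moment n theta.
Proof.
elim: n theta => [|n IH] theta t0.
  rewrite derive1nS derive1n0 derive1E expr0 mul1r.
  by have [] := is_derive_levy_rep _ t0.
rewrite derive1nS derive1E.
(* The induction hypothesis holds at positive points only, hence near [theta], which is enough for
   the derivative. *)
have nE : \forall x \near theta, derive1n n.+1 f x = ((-1) ^+ n \*o moment n) x.
  by near=> x; rewrite IH//; near: x; exact: lt_nbhsr.
rewrite (near_eq_derive _ nE).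
have [_ ->] := is_deriveZ ((-1) ^+ n) (is_derive_moment n _ t0).
by rewrite /GRing.scale/= exprS mulrN; ring.
Unshelve. all: by end_near. Qed.

Lemma bernstein_levy_rep : (forall x, 0 < x -> 0 <= f x) -> bernstein f.
Proof.
move=> f0; split => // n x x0.
  case: n => [|n]; first by rewrite derive1n0; have [] := is_derive_levy_rep _ x0.
  have nE : \forall z \near x, ((-1) ^+ n \*o moment n) z = derive1n n.+1 f z.
    by near=> z; rewrite derive1n_levy_rep//; near: z; exact: lt_nbhsr.
  apply: near_eq_derivable nE _.
  by have [] := is_deriveZ ((-1) ^+ n) (is_derive_moment n _ x0).
rewrite derive1n_levy_rep// mulrA -exprD addnn -mul2n exprM sqrrN !expr1n mul1r.
apply: levy_ge0; first exact: tame_moment.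
by move=> y y0; rewrite /moment_fun mulr_ge0 ?exprn_ge0 ?expR_ge0.
Unshelve. all: by end_near. Qed.

(** Bernoulli's inequality for [z = expR (- (theta * y))], integrated by [L]; the term [q] only
    helps, as [q <= n.+1%:R * q]. *)
Lemma levy_rep_submul (n : nat) (theta : R) : 0 < theta ->
  f (n.+1%:R * theta) <= n.+1%:R * f theta.
Proof.
have [q0 _ _ _ _] := Lrep.
move=> t0; have nt : 0 < n.+1%:R * theta by rewrite mulr_gt0// ltr0n.
have t1 := weight_scale_tame _ t0.
rewrite !levy_repE// mulrDr lerD//; first by rewrite ler_peMl// ler1n.
rewrite -levyZ//; apply: levy_le; [exact: weight_scale_tame|exact: tameZ|].
move=> y y0.
have -> : expR (- (n.+1%:R * theta * y)) = expR (- (theta * y)) ^+ n.+1.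
  by rewrite -expRM_natl; congr expR; ring.
have e0 := expR_ge0 (- (theta * y)).
have e1 : expR (- (theta * y)) <= 1.
  by rewrite -expR0 ler_expR oppr_le0 mulr_ge0// ltW.
exact: sub1_exprn_le.
Qed.

(** This is [q + L(1 - exp(- z y))], written by components because [L] acts on real functions. *)
Definition levy_ext (z : (R[i])^o) : (R[i])^o :=
  (q + L (re_fun (complex.Re z) (complex.Im z))) +i*
  L (im_fun (complex.Re z) (complex.Im z)).

(** The candidate derivative [L(y exp(- z y))]. *)
Definition dlevy_ext (z : (R[i])^o) : R[i] :=
  L (dre_fun (complex.Re z) (complex.Im z)) -i*
  L (dim_fun (complex.Re z) (complex.Im z)).

Lemma levy_ext_real (x : R) : 0 < x -> levy_ext x%:C = (f x)%:C.
Proof.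
move=> x0; rewrite /levy_ext/= levy_repE//.
have -> : re_fun x 0 = (fun y => 1 - expR (- (x * y))).
  by apply/funext => y; rewrite /re_fun mul0r cos0 mulr1.
have -> : L (im_fun x 0) = 0.
  have -> : im_fun x 0 = (fun y => 0 * weight y).
    by apply/funext => y; rewrite /im_fun mul0r sin0 mulr0 mul0r.
  by rewrite levyZ ?mul0r//; exact: tame_weight.
by [].
Qed.

Lemma Re_levy_ext (z : (R[i])^o) : 0 < complex.Re z ->
  f (complex.Re z) <= complex.Re (levy_ext z).
Proof.
move=> z0; rewrite levy_repE//= lerD2l.
apply: levy_le; [exact: weight_scale_tame|exact: tame_re|].
by move=> y y0; rewrite /re_fun lerD2l lerN2 ler_piMr ?expR_ge0// cos_le1.
Qed.

Lemma levy_ext_remainder (s t : R) : 0 < s -> exists2 B : R, 0 <= B &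
  forall a b : R, `|a| < s / 2 ->
  `|L (re_fun (s + a) (t + b)) - L (re_fun s t) -
    (a * L (dre_fun s t) + b * L (dim_fun s t))| <= B * (a ^+ 2 + b ^+ 2) /\
  `|L (im_fun (s + a) (t + b)) - L (im_fun s t) -
    (b * L (dre_fun s t) - a * L (dim_fun s t))| <= B * (a ^+ 2 + b ^+ 2).
Proof.
move=> s0; have s2 : 0 < s / 2 by rewrite divr_gt0.
have [B B0 hB] := @levy_remainder 1 _ s2.
exists (B * 3); first by rewrite mulr_ge0.
move=> a b ab; have sa : 0 < s + a by move: ab; rewrite ltr_norml => /andP[]; lra.
have ? := tame_re _ t s0; have ? := tame_re _ (t + b) sa.
have ? := tame_im _ t s0; have ? := tame_im _ (t + b) sa.
have ? := tame_dre _ t s0; have ? := tame_dim _ t s0.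
have tA : tame (fun y => a * dre_fun s t y) by exact: tameZ.
have tA' : tame (fun y => b * dre_fun s t y) by exact: tameZ.
have tB : tame (fun y => b * dim_fun s t y) by exact: tameZ.
have tB' : tame (fun y => a * dim_fun s t y) by exact: tameZ.
have e0 : 0 <= 3 * (a ^+ 2 + b ^+ 2) by rewrite mulr_ge0// addr_ge0// sqr_ge0.
rewrite -!mulrA; split.
- rewrite -levyB// -!levyZ// -levyD// -levyB; [|exact: tameB|exact: tameD].
  apply: hB => //; first by apply: tameB; [exact: tameB|exact: tameD].
  by move=> y y0; apply: re_remainder => //; exact: ltW.
- rewrite -levyB// -!levyZ// -levyB// -levyB; [|exact: tameB|exact: tameB].
  apply: hB => //; first by apply: tameB; exact: tameB.
  by move=> y y0; apply: im_remainder => //; exact: ltW.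
Qed.

Lemma levy_ext_holomorphic : holomorphic_on levy_ext (@Hplane R).
Proof.
move=> z z0; rewrite /Hplane/= in z0.
have [B B0 hB] := levy_ext_remainder _ (complex.Im z) z0.
suff [] : is_derive z 1 levy_ext (dlevy_ext z) by [].
(* The factor 2 comes from bounding the modulus by the sum of the two components, each with constant
   [B]. *)
apply: (@is_derive_quadratic R[i] levy_ext z _ (2 * B)%:C (complex.Re z / 2)%:C).
- by rewrite ltcR divr_gt0.
- by rewrite ler0c mulr_ge0.
move=> h hh.
have hh' : `|complex.Re h| < complex.Re z / 2.
  by rewrite -ltcR (le_lt_trans (normc_ge_Re _)).
rewrite -add_Re2_Im2 -rmorphM/=.
have [h1 h2] := hB _ (complex.Im h) hh'.
apply: (le_trans (normc_le_ReIm _ _)); rewrite lecR.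
have -> : 2 * B * (complex.Re h ^+ 2 + complex.Im h ^+ 2) =
  B * (complex.Re h ^+ 2 + complex.Im h ^+ 2) +
  B * (complex.Re h ^+ 2 + complex.Im h ^+ 2) by ring.
case: z z0 h1 h2 {hB hh hh'} => s t /= s0; case: h => a b /= h1 h2.
apply: lerD.
  apply: le_trans h1; rewrite le_eqVlt; apply/orP; left; apply/eqP.
  by congr (`| _ |); ring.
apply: le_trans h2; rewrite le_eqVlt; apply/orP; left; apply/eqP.
by congr (`| _ |); ring.
Qed.

End levy_representation.

(** * Denjoy-Wolff point at infinity and the inequality [theta <= f theta] *)

Section BF_infty_ge_id.
Context {R : realType}.

Lemma BF_infty_ge_id (f : R -> R) :
  (forall a b, 0 < a -> a <= b -> f a <= f b) ->
  BF_infty f -> forall theta, 0 < theta -> theta <= f theta.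
Proof.
move=> fmono [fid|[_ _ [F [_ FE FH Fcvg]]]] theta t0; first by rewrite fid.
rewrite leNgt; apply/negP => ft.
(* By monotonicity, [f theta < theta] traps the orbit between 0 and [theta]; this contradicts
   convergence to infinity on the compact set formed by the point [theta]. *)
have iterE n : exists x, [/\ 0 < x, x <= theta & iter n F theta%:C = x%:C].
  elim: n => [|n [x [x0 xt xE]]]; first by exists theta.
  exists (f x); split.
  - by have := FH x%:C; rewrite FE//; apply.
  - by rewrite (le_trans (fmono _ _ x0 xt))// ltW.
  - by rewrite iterS xE FE.
have K : [set (theta%:C : (R[i])^o)] `<=` @Hplane R by move=> _ ->.
have [N _ hN] := Fcvg _ K (@compact_set1 _ _) (Num.trunc theta).+1.
have := hN N (leqnn N) _ erefl; have [x [x0 xt ->]] := iterE N.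
rewrite normc_def/= expr0n addr0 sqrtr_sqr (ger0_norm (ltW x0)).
rewrite -(rmorph_nat (real_complex R)) ltcR => h.
by have := truncnS_gt theta; lra.
Qed.

Lemma continuous_Re : continuous (@complex.Re R : (R[i])^o -> R).
Proof.
move=> z A /nbhs_ballP[e /= e0 eA]; apply/nbhs_ballP; exists e%:C => /=.
  by rewrite ltcR.
move=> y; rewrite -ball_normE/= => h; apply: eA; rewrite -ball_normE/= -ltcR.
apply: le_lt_trans h; apply: le_trans (normc_ge_Re _).
by case: z => ? ?; case: y => ? ?.
Qed.

Lemma levy_rep_BF_infty (f : R -> R) q L : levy_rep f q L ->
  (forall a, 0 < a -> a <= f a) ->
  (forall a b, 0 < a -> a <= b -> f a - a <= f b - b) ->
  BF_infty f.
Proof.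
move=> Lrep fge fmono.
have [fid|/existsNP[x0 /not_implyP[x00 /eqP fx0]]] :=
  pselect (forall x, 0 < x -> f x = x); first by left.
(* If the gap vanished at [x], submultiplicativity would make it nonpositive at [n.+1%:R * x >= x0],
   and monotonicity would then force [f x0 = x0]. *)
have gap_gt0 (x : R) : 0 < x -> 0 < f x - x.
  move=> xp; rewrite lt_neqAle subr_ge0 fge// andbT eq_sym.
  apply/eqP => fxx; have fx : f x = x by lra.
  pose n := Num.trunc (x0 / x).
  have xn : x0 <= n.+1%:R * x.
    by rewrite -ler_pdivrMr// ltW// truncnS_gt.
  have := levy_rep_submul _ _ _ Lrep n _ xp; rewrite fx => h.
  have := fmono _ _ x00 xn.
  have := fge _ x00; move: fx0; rewrite neq_lt => /orP[]; lra.
right; split.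
- split; first by apply: (bernstein_levy_rep _ _ _ Lrep) => x xp;
    rewrite (le_trans (ltW xp))// fge.
  exists 1; split => //; have := fge 1 ltr01.
  by move=> h; rewrite gt_eqF// (lt_le_trans ltr01).
- by exists x0.
exists (levy_ext q L); split.
- exact: levy_ext_holomorphic Lrep.
- by move=> x xp; exact: levy_ext_real Lrep _ xp.
- move=> z zp; rewrite /Hplane/= in zp *.
  by rewrite (lt_le_trans zp)// (le_trans (fge _ zp))// (Re_levy_ext _ _ _ Lrep).
move=> K KH Kc M.
have [->|/set0P K0] := eqVneq K set0; first by apply: nearW.
(* The smallest real part on [K] makes the growth rate [w] uniform on [K]. *)
have [|c /set_mem Kc' cmin] := @compact_EVT_min _ _ (@complex.Re R : (R[i])^o -> R) K K0 Kc.
  by apply: continuous_subspaceT; exact: continuous_Re.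
have c0 : 0 < complex.Re c := KH _ Kc'.
set w := f (complex.Re c) - complex.Re c.
have w0 : 0 < w by exact: gap_gt0.
(* Each application of the extension raises the real part by at least the gap there, which is at
   least the gap [w] at [complex.Re c]. *)
have growth n z : K z -> complex.Re c + n%:R * w <= complex.Re (iter n (levy_ext q L) z).
  move=> Kz; elim: n => [|n IH]; first by rewrite mul0r addr0 cmin// mem_set.
  rewrite iterS; set y := iter n _ z in IH *.
  have cy : complex.Re c <= complex.Re y.
    by apply: le_trans IH; rewrite lerDl mulr_ge0// ltW.
  have y0 : 0 < complex.Re y by exact: lt_le_trans cy.
  apply: le_trans (Re_levy_ext _ _ _ Lrep _ y0).
  have := fmono _ _ c0 cy; rewrite -/w mulrS mulrDl mul1r; lra.
exists (Num.trunc (M%:R / w)).+1 => // n /= hn z Kz.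
apply: lt_le_trans (normc_ge_Re _).
rewrite -(rmorph_nat (real_complex R)) ltcR.
apply: lt_le_trans (ler_norm _).
apply: lt_le_trans (growth n z Kz).
have : M%:R < n%:R * w.
  rewrite -ltr_pdivrMr// (lt_le_trans (truncnS_gt _))// ler_nat//.
lra.
Qed.

End BF_infty_ge_id.

(** * Support of a law read off its Laplace transform *)

Section laplace_support.
Context {R : realType}.

(** Almost sure events are handled through their complements, since negligible sets are stable under
    subsets and countable unions. *)
Lemma probability1P (d : measure_display) (T : measurableType d)
    (P : probability T R) (A : set T) :
  measurable A -> (P A = 1%E) <-> P.-negligible (~` A).
Proof.
move=> mA; split=> [PA|].
  have := probability_setC P mA; rewrite PA subee// => h.
  by apply/negligibleP; [exact: measurableC|exact: h].
move/(measure_negligible (measurableC mA)) => h.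
have {}h := etrans (esym (probability_setC P mA)) h.
have /fineK PE : P A \is a fin_num by exact: fin_num_measure.
by move: h; rewrite -PE -EFinB => -[/eqP]; rewrite subr_eq0 => /eqP <-.
Qed.

Lemma measurable_ege (x : \bar R) : measurable [set y : \bar R | (x <= y)%E].
Proof.
rewrite (_ : [set y | _] = [set` Interval (BLeft x) +oo%O]).
  exact: emeasurable_itv.
by apply/seteqP; split => y /=; rewrite in_itv/= andbT.
Qed.

Lemma measurable_elt (x : \bar R) : measurable [set y : \bar R | (y < x)%E].
Proof.
rewrite (_ : [set y | _] = [set` Interval -oo%O (BLeft x)]).
  exact: emeasurable_itv.
by apply/seteqP; split => y /=; rewrite in_itv.
Qed.

Section one_measure.
Variables (mu : probability (\bar R) R) (f : R -> R) (x : R).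
Hypothesis mu_ge0 : mu (@enonneg R) = 1%E.
Hypothesis x0 : 0 < x.
Hypothesis laplace : forall theta, 0 < theta ->
  fin_mean mu (fun y => expR (- (theta * y))) = expR (- (x * f theta)).

Lemma shifted_laplace theta : 0 < theta ->
  fin_mean mu (fun y => expR (theta * x) * expR (- (theta * y))) =
  expR (- (x * (f theta - theta))).
Proof.
move=> t0; rewrite fin_meanZ; last exact: bounded_meas_expR (ltW t0).
by rewrite laplace// -expRD; congr expR; ring.
Qed.

(** Removing the null set below [x] from both integrals leaves only points where the comparison is
    assumed. *)
Lemma fin_mean_le_supp (phi psi : R -> R) : bounded_meas phi -> bounded_meas psi ->
  mu [set y : \bar R | (x%:E <= y)%E] = 1%E ->
  (forall y, x <= y -> phi y <= psi y) -> fin_mean mu phi <= fin_mean mu psi.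
Proof.
move=> h1 h2 mux h.
have mE := @measurable_Efin R; have mN := measurable_elt x%:E.
have N0 : mu [set y | (y < x%:E)%E] = 0.
  have /(probability1P _ _ _ _ (measurable_ege x%:E))/measure_negligible := mux.
  rewrite (_ : ~` _ = [set y | (y < x%:E)%E]); first by apply.
  by apply/seteqP; split => y /=; rewrite ltNge => /negP.
have i1 := fin_mean_integrable mu _ h1; have i2 := fin_mean_integrable mu _ h2.
rewrite /fin_mean /Rintegral (negligible_integral mN mE i1 N0).
rewrite (negligible_integral mN mE i2 N0).
apply: le_Rintegral.
- exact: measurableD.
- by apply: integrableS i1 => //; exact: measurableD.
- by apply: integrableS i2 => //; exact: measurableD.
move=> y [/andP[y0 yoo] /negP]; rewrite -leNgt => xy; apply: h.
by move: xy; rewrite -{1}(@fineK _ y) ?lee_fin// ge0_fin_numE.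
Qed.

Lemma supp_gap_mono : mu [set y : \bar R | (x%:E <= y)%E] = 1%E ->
  forall a b, 0 < a -> a <= b -> f a - a <= f b - b.
Proof.
move=> mux a b a0 ab; have b0 : 0 < b by exact: lt_le_trans ab.
suff : expR (- (x * (f b - b))) <= expR (- (x * (f a - a))).
  by rewrite ler_expR lerN2 ler_pM2l.
rewrite -!shifted_laplace//; apply: fin_mean_le_supp => //.
- by apply: bounded_measZ; exact: bounded_meas_expR (ltW b0).
- by apply: bounded_measZ; exact: bounded_meas_expR (ltW a0).
move=> y xy; rewrite -!expRD ler_expR.
have : 0 <= (b - a) * (y - x) by rewrite mulr_ge0 ?subr_ge0.
lra.
Qed.

Lemma supp_ge_id : mu [set y : \bar R | (x%:E <= y)%E] = 1%E ->
  forall a, 0 < a -> a <= f a.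
Proof.
move=> mux a a0.
suff : expR (- (x * (f a - a))) <= 1.
  by rewrite -expR0 ler_expR oppr_le0 pmulr_rge0// subr_ge0.
have /andP[_] := fin_mean1 mu; apply: le_trans.
rewrite -shifted_laplace//; apply: fin_mean_le_supp => //.
- by apply: bounded_measZ; exact: bounded_meas_expR (ltW a0).
- exact: bounded_meas_cst.
move=> y xy; rewrite -!expRD -expR0 ler_expR.
have : 0 <= a * (y - x) by rewrite mulr_ge0 ?subr_ge0// ltW.
lra.
Qed.

(* Chernoff bound, letting theta tend to infinity. *)
Lemma ge_id_supp_gap (e : R) : 0 < e -> (forall a, 0 < a -> a <= f a) ->
  mu [set y : \bar R | (0 <= y <= (x - e)%:E)%E] = 0%E.
Proof.
move=> e0 fge; set N := [set y | _].
have mN : measurable N.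
  rewrite (_ : N = [set` Interval (BLeft 0%E) (BRight (x - e)%:E)]).
    exact: emeasurable_itv.
  by apply/seteqP; split => y /=; rewrite in_itv.
have mE := @measurable_Efin R.
have /fineK muE : mu N \is a fin_num by exact: fin_num_measure.
(* Markov's inequality for [expR (- (theta * y))] gives [exp(- theta e)] times
   [exp(- x (f theta - theta))], and the second factor is at most 1. *)
have bnd theta : 0 < theta -> fine (mu N) <= expR (- (theta * e)).
  move=> t0; have i1 := fin_mean_integrable mu _ (bounded_meas_expR _ (ltW t0)).
  have mf := measurable_int _ i1.
  have NE : N `<=` [set y : \bar R | (0 <= y < +oo)%E].
    by move=> y /andP[y0 yx]/=; rewrite y0 (le_lt_trans yx)// ltry.
  have h1 : ((expR (- (theta * (x - e))))%:E * mu N <=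
      \int[mu]_(y in N) (expR (- (theta * fine y)))%:E)%E.
    rewrite -integral_cst//; apply: ge0_le_integral => //.
    - by move=> y _; rewrite lee_fin expR_ge0.
    - exact: (measurable_funS mE NE mf).
    move=> y Ny; have /andP[y0 yoo] := NE _ Ny; case/andP: Ny => _ yx.
    rewrite lee_fin ler_expR lerN2.
    apply: ler_wpM2l; first exact: ltW.
    by rewrite -lee_fin fineK// ge0_fin_numE.
  have g0 (y : \bar R) : [set y : \bar R | (0 <= y < +oo)%E] y ->
      (0 <= (EFin \o (fun y : \bar R => expR (- (theta * fine y)))) y)%E.
    by move=> _; rewrite lee_fin expR_ge0.
  have h2 := le_trans h1 (ge0_subset_integral mu mN mE mf g0 NE).
  have : ((expR (- (theta * (x - e))) * fine (mu N))%:E <=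
      (fin_mean mu (fun y => expR (- (theta * y))))%:E)%E.
    rewrite EFinM muE /fin_mean /Rintegral fineK//.
    exact: integrable_fin_num.
  rewrite lee_fin laplace// (expRN (theta * (x - e))) ler_pdivrMl ?expR_gt0//.
  move=> /le_trans; apply; rewrite -expRD ler_expR.
  have : 0 <= x * (f theta - theta) by rewrite mulr_ge0 ?subr_ge0 ?fge//; exact: ltW.
  lra.
have r0 : 0 <= fine (mu N) by rewrite fine_ge0.
rewrite -muE; congr (_%:E); apply/eqP; rewrite eq_le r0 andbT leNgt.
apply/negP => rp; set r := fine (mu N) in rp bnd.
(* This [theta] turns the bound into [r <= exp(- 1 / r)], which contradicts
   [1 + 1 / r <= exp(1 / r)]. *)
have t0 : 0 < (r * e)^-1 by rewrite invr_gt0 mulr_gt0.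
have := bnd _ t0; rewrite invfM -mulrA mulVf ?gt_eqF// mulr1.
have := expR_ge1Dx r^-1; rewrite expRN => h1 h2.
have : expR r^-1 <= r^-1 by rewrite -lef_pV2 ?posrE ?expR_gt0 ?invr_gt0// invrK.
lra.
Qed.

(** The points below [x] are the negative ones, a null set, and those in the null sets [N n] at
    distance at least [1 / (n + 1)] from [x]. *)
Lemma ge_id_supp : (forall a, 0 < a -> a <= f a) ->
  mu [set y : \bar R | (x%:E <= y)%E] = 1%E.
Proof.
move=> fge; apply/probability1P; first exact: measurable_ege.
have neg0 : mu.-negligible (~` @enonneg R).
  by apply/probability1P => //; exact: measurable_ege.
pose N n := [set y : \bar R | (0 <= y <= (x - n.+1%:R^-1)%:E)%E].
have negN : mu.-negligible (\bigcup_n N n).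
  apply: negligible_bigcup => n; apply/negligibleP; last first.
    by apply: ge_id_supp_gap => //; rewrite invr_gt0.
  rewrite (_ : N n = [set` Interval (BLeft 0%E) (BRight (x - n.+1%:R^-1)%:E)]).
    exact: emeasurable_itv.
  by apply/seteqP; split => y /=; rewrite in_itv.
apply: negligibleS (negligibleU neg0 negN) => y /= /negP; rewrite -ltNge => yx.
have [y0|y0] := leP 0%E y; last by left => /=; rewrite /enonneg/= leNgt y0.
right; case: y y0 yx => [y| |]//; rewrite lee_fin lte_fin => y0 yx.
exists (Num.trunc (x - y)^-1) => //; rewrite /N/= !lee_fin y0/=.
rewrite lerBrDr -lerBrDl -[leRHS]invrK lef_pV2 ?posrE ?ltr0n ?invr_gt0 ?subr_gt0//.
by rewrite ltW// truncnS_gt.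
Qed.

End one_measure.

End laplace_support.

(** * Transition kernels and path events of the branching process *)

Section branching.
Context {R : realType} {d : measure_display} {Omega : measurableType d}.
Variables (k : R -> R -> \bar R -> probability (\bar R) R)
  (P : R -> \bar R -> probability Omega R) (Z : R -> Omega -> \bar R)
  (v : R -> R -> R -> R).
Hypothesis hbp : branching_process k P Z.
Hypothesis hlap : laplace_exponents k v.

Lemma measurable_preimage_state t (B : set (\bar R)) : 0 <= t -> measurable B ->
  measurable (Z t @^-1` B).
Proof.
have [_ [mZ _ _]] := hbp => t0 mB.
by rewrite -[X in measurable X]setTI; exact: mZ.
Qed.

(** The Markov property with past reduced to time [s], on the almost sure event [Z s = x], where the
    integrand is constant. *)
Lemma law_state s t (x : \bar R) (B : set (\bar R)) : 0 <= s <= t -> (0 <= x)%E ->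
  measurable B -> P s x (Z t @^-1` B) = k s t x B.
Proof.
have [_ [mZ Z0 mar]] := hbp => /andP[s0 st] x0 mB.
have t0 : 0 <= t by exact: le_trans st.
have mx : measurable [set x] by exact: emeasurable_set1.
have mA : measurable (Z s @^-1` [set x]) by exact: measurable_preimage_state.
have mZB : measurable (Z t @^-1` B) by exact: measurable_preimage_state.
have PA : P s x (Z s @^-1` [set x]) = 1%E by exact: Z0.
have := mar s s t x (Z s @^-1` [set x]) B.
rewrite s0 lexx => /(_ isT st x0) h.
have {}h := h (sub_sigma_algebra _) mB.
have -> : P s x (Z t @^-1` B) = P s x (Z s @^-1` [set x] `&` Z t @^-1` B).
  have /(probability1P _ _ _ _ mA) nA := PA.
  rewrite -(@measureU0 _ _ _ _ (Z s @^-1` [set x] `&` Z t @^-1` B)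
    (~` (Z s @^-1` [set x]) `&` Z t @^-1` B)).
  - congr (P s x _); rewrite -setIUl setUv setTI//.
  - exact: measurableI.
  - by apply: measurableI => //; exact: measurableC.
  - apply: measure_negligible; first by apply: measurableI => //; exact: measurableC.
    by apply: negligibleS nA; exact: subIsetl.
rewrite h; last by exists s, [set x]; rewrite lexx.
rewrite (eq_integral (cst (k s t x B))); last by move=> w /set_mem/= ->.
by rewrite integral_cst// [X in (_ * X)%E]PA mule1.
Qed.

Lemma kernel_laplace s t x theta : 0 <= s <= t -> 0 < x -> 0 < theta ->
  fin_mean (k s t x%:E) (fun y => expR (- (theta * y))) =
  expR (- (x * v s t theta)).
Proof.
move=> st x0 t0; rewrite /fin_mean /Rintegral.
under eq_integral do rewrite -mulNr.
by rewrite hlap//= mulNr.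
Qed.

Lemma laplace_exponent_mono s t : 0 <= s <= t ->
  forall a b, 0 < a -> a <= b -> v s t a <= v s t b.
Proof.
move=> st a b a0 ab; have b0 : 0 < b by exact: lt_le_trans ab.
suff : expR (- (1 * v s t b)) <= expR (- (1 * v s t a)).
  by rewrite ler_expR lerN2 !mul1r.
rewrite -!kernel_laplace//; apply: fin_mean_le.
- exact: bounded_meas_expR (ltW b0).
- exact: bounded_meas_expR (ltW a0).
by move=> y y0; rewrite ler_expR lerN2 ler_wpM2r.
Qed.

Lemma kernel_levy_rep s t : 0 <= s <= t ->
  exists q L, levy_rep (v s t) q L.
Proof.
(* Starting from [1 / (m + 1)] makes the exponent of the Laplace transform match the rescaling by
   [m.+1]. *)
move=> st; apply: (levy_rep_exists (fun m => k s t (m.+1%:R^-1)%:E)) => m theta t0.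
by rewrite hlap// invr_gt0 ltr0n.
Qed.

Lemma kernel_enonneg s t x : 0 <= s <= t -> 0 < x -> k s t x%:E (@enonneg R) = 1%E.
Proof.
have [[h _ _ _ _] _] := hbp => st x0; apply: h => //.
by rewrite lee_fin ltW.
Qed.

Lemma event_ge s t x : 0 <= s <= t -> 0 < x ->
  P s x%:E [set w | (x%:E <= Z t w)%E] = k s t x%:E [set y | (x%:E <= y)%E].
Proof.
move=> st x0; apply: (law_state s t x%:E [set y | (x%:E <= y)%E]) => //.
  by rewrite lee_fin ltW.
exact: measurable_ege.
Qed.

Lemma event_ge_ge_id s t x : 0 <= s <= t -> 0 < x ->
  P s x%:E [set w | (x%:E <= Z t w)%E] = 1%E ->
  forall theta, 0 < theta -> theta <= v s t theta.
Proof.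
move=> st x0; rewrite event_ge// => h.
exact: (supp_ge_id _ _ _ x0 (fun theta => kernel_laplace _ _ _ theta st x0) h).
Qed.

Lemma ge_id_event_ge s t x : 0 <= s <= t -> 0 < x ->
  (forall theta, 0 < theta -> theta <= v s t theta) ->
  P s x%:E [set w | (x%:E <= Z t w)%E] = 1%E.
Proof.
move=> st x0 h; rewrite event_ge//.
exact: (ge_id_supp _ _ _ (kernel_enonneg _ _ _ st x0) x0
  (fun theta => kernel_laplace _ _ _ theta st x0) h).
Qed.

Lemma ge_id_BF_infty s t : 0 <= s <= t ->
  (forall theta, 0 < theta -> theta <= v s t theta) -> BF_infty (v s t).
Proof.
move=> st h; have [q [L Lrep]] := kernel_levy_rep _ _ st.
apply: (levy_rep_BF_infty _ _ _ Lrep) => //.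
have := ge_id_event_ge _ _ _ st ltr01 h; rewrite event_ge// => h1.
exact: (supp_gap_mono _ _ _ ltr01
  (fun theta => kernel_laplace _ _ _ theta st ltr01) h1).
Qed.

(** The hypothesis speaks of positive finite starting points; at 0 and [+oo] the kernel is a Dirac
    mass, and this settles the remaining cases. *)
Lemma kernel_below_null t u (z : \bar R) (c : R) : 0 <= t <= u -> 0 <= c ->
  (c%:E <= z)%E ->
  (forall x, 0 < x -> P t x%:E [set w | (x%:E <= Z u w)%E] = 1%E) ->
  k t u z [set y | (y < c%:E)%E] = 0%E.
Proof.
have [[_ _ _ _ [_ _ k0 koo]] _] := hbp => tu c0 cz h.
have mN := measurable_elt c%:E.
case: z cz => [z| |]//; last first.
  by move=> _; rewrite koo// diracE memNset//= ltNge leey.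
rewrite lee_fin => cz; have : 0 <= z by exact: le_trans cz.
rewrite le_eqVlt => /predU1P[z0|z0].
  by rewrite -z0 in cz *; rewrite k0// diracE memNset//= lte_fin ltNge cz.
have := h z z0; rewrite event_ge// => /(probability1P _ _ _ _ (measurable_ege z%:E)) nz.
apply: measure_negligible => //; apply: negligibleS nz => y /= yc.
by apply/negP; rewrite -ltNge (lt_le_trans yc)// lee_fin.
Qed.

Lemma event_ge_monotone s t u x : 0 <= s <= t -> t <= u -> 0 < x ->
  (forall s t x, 0 <= s <= t -> 0 < x ->
    P s x%:E [set w | (x%:E <= Z t w)%E] = 1%E) ->
  P s x%:E [set w | (Z t w <= Z u w)%E] = 1%E.
Proof.
have [_ [mZ _ mar]] := hbp => st tu x0 h.
have /andP[s0 st'] := st.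
have t0 : 0 <= t by exact: le_trans st'.
have u0 : 0 <= u by exact: le_trans tu.
have su : 0 <= s <= u by rewrite s0 (le_trans st').
have x0' : (0 <= x%:E)%E by rewrite lee_fin ltW.
apply/probability1P.
  rewrite -[X in measurable X]setTI; apply: measurable_lee => //; exact: mZ.
have neg0 : (P s x%:E).-negligible (~` (Z u @^-1` @enonneg R)).
  have mE : measurable (@enonneg R) by exact: measurable_ege.
  apply/probability1P; first exact: measurable_preimage_state.
  by rewrite law_state// kernel_enonneg.
(* Countably many events cover [Z u < Z t]: a nonnegative rational level, enumerated by [unpickle],
   separates the two values. *)
pose F n := if @unpickle rat n is Some r then
    [set w | 0 <= ratr r :> R /\ ((ratr r)%:E <= Z t w)%E /\ (Z u w < (ratr r)%:E)%E]
  else set0.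
have negF : (P s x%:E).-negligible (\bigcup_n F n).
  apply: negligible_bigcup => n; rewrite /F.
  case: (unpickle n) => [r|]; last exact: negligible_set0.
  have [r0|r0] := leP (0 : R) (ratr r); last first.
    by apply: (negligibleS _ (negligible_set0 _)) => w /= [].
  set A := Z t @^-1` [set y | ((ratr r)%:E <= y)%E].
  set B := [set y : \bar R | (y < (ratr r)%:E)%E].
  have mB : measurable B by exact: measurable_elt.
  have mA : measurable A.
    by apply: measurable_preimage_state => //; exact: measurable_ege.
  apply: (@negligibleS _ _ _ _ (A `&` Z u @^-1` B)).
    by move=> w /= [_ []].
  apply/negligibleP.
    by apply: measurableI => //; exact: measurable_preimage_state.
  (* The Markov property at time [t]: on [A] the state is above the level, so the kernel gives [B]
     no mass. *)
  rewrite [LHS](mar s t u)//.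
    apply: integral0_eq => w Aw.
    have tu' : 0 <= t <= u by rewrite t0 tu.
    by apply: kernel_below_null => // y y0; exact: h.
  apply: sub_sigma_algebra; exists t, [set y | ((ratr r)%:E <= y)%E].
  by split => //; [rewrite st' lexx|exact: measurable_ege].
apply: negligibleS (negligibleU neg0 negF) => w /= /negP; rewrite -ltNge => ut.
have [zu0|zu0] := leP 0%E (Z u w); last first.
  by left => /=; rewrite /enonneg/= leNgt zu0.
right.
have [r [ur rt]] : exists r : rat, (Z u w < (ratr r)%:E)%E /\ ((ratr r)%:E <= Z t w)%E.
  case: (Z u w) (Z t w) ut zu0 => [a| |] [b| |]//; rewrite ?lte_fin => ab _.
    have [r /[!in_itv]/= /andP[ar rb]] := rat_in_itvoo ab.
    by exists r; rewrite lte_fin lee_fin ar ltW.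
  (* When [Z t] is infinite, any rational above [Z u] serves. *)
  have a1 : a < a + 1 by rewrite ltrDl.
  have [r /[!in_itv]/= /andP[ar rb]] := rat_in_itvoo a1.
  by exists r; rewrite lte_fin leey ar.
exists (pickle r) => //; rewrite /F pickleK /=; split => //.
by rewrite -lee_fin (le_trans zu0)// ltW.
Qed.

(** Almost surely [Z s = x]. *)
Lemma monotone_event_ge s t x : 0 <= s <= t -> 0 < x ->
  P s x%:E [set w | (Z s w <= Z t w)%E] = 1%E ->
  P s x%:E [set w | (x%:E <= Z t w)%E] = 1%E.
Proof.
have [_ [mZ Z0 _]] := hbp => /andP[s0 st] x0.
have t0 : 0 <= t by exact: le_trans st.
have x0' : (0 <= x%:E)%E by rewrite lee_fin ltW.
move=> /probability1P h; have {}h : (P s x%:E).-negligible (~` [set w | (Z s w <= Z t w)%E]).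
  apply: h; rewrite -[X in measurable X]setTI.
  by apply: measurable_lee => //; exact: mZ.
have /probability1P hs := Z0 _ _ s0 x0'.
have {}hs := hs (measurable_preimage_state _ _ s0 (emeasurable_set1 x%:E)).
apply/probability1P.
  exact: (measurable_preimage_state _ _ t0 (measurable_ege x%:E)).
apply: negligibleS (negligibleU h hs) => w /= xw.
have [e|e] := pselect (Z s w = x%:E); last by right.
by left; rewrite e.
Qed.

End branching.

Theorem mainTheorem12 (R : realType) (d : measure_display)
    (Omega : measurableType d)
    (k : R -> R -> \bar R -> probability (\bar R) R)
    (P : R -> \bar R -> probability Omega R) (Z : R -> Omega -> \bar R)
    (v : R -> R -> R -> R) :
  branching_process k P Z ->
  laplace_exponents k v ->
  let cond_a := forall s t : R, 0 <= s <= t -> BF_infty (v s t) in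
  let cond_b := forall (s t u x : R), 0 <= s <= t -> t <= u -> 0 < x ->
      P s x%:E [set w | (Z t w <= Z u w)%E] = 1%E in
  let cond_c := forall (s t x : R), 0 <= s <= t -> 0 < x ->
      P s x%:E [set w | (x%:E <= Z t w)%E] = 1%E in
  let cond_d := forall (s t : R), 0 <= s <= t ->
      exists x : R, 0 < x /\ P s x%:E [set w | (x%:E <= Z t w)%E] = 1%E in
  [/\ cond_a <-> cond_b, cond_b <-> cond_c & cond_c <-> cond_d].
Proof.
move=> hbp hlap cond_a cond_b cond_c cond_d.
have ac : cond_a -> cond_c.
  move=> ha s t x st x0; apply: (ge_id_event_ge _ _ _ _ hbp hlap) => //.
  apply: BF_infty_ge_id (ha _ _ st).
  exact: (laplace_exponent_mono _ _ hlap).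
have cb : cond_c -> cond_b.
  by move=> hc s t u x st tu x0; apply: (event_ge_monotone _ _ _ hbp).
have bc : cond_b -> cond_c.
  move=> hb s t x st x0; apply: (monotone_event_ge _ _ _ hbp) => //.
  by have /andP[s0 st'] := st; apply: hb => //; rewrite s0 lexx.
have cd : cond_c -> cond_d by move=> hc s t st; exists 1; split => //; exact: hc.
(* One starting point [x] suffices, because the inequality [theta <= v s t theta] extracted from it
   does not involve [x]. *)
have da : cond_d -> cond_a.
  move=> hd s t st; have [x [x0 hx]] := hd _ _ st.
  apply: (ge_id_BF_infty _ _ _ _ hbp hlap) => //.
  exact: (event_ge_ge_id _ _ _ _ hbp hlap _ _ _ st x0 hx).
by split; split => // h; [exact/cb/ac|exact/da/cd/bc|exact/ac/da].
Qed.
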